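(* Neither left stability, right stability nor stability is preserved under quotients, for semigroups or for biacts. That is, for each property $P\in\{\text{left stable},\text{right stable},\text{stable}\}$: (a) there exist a semigroup $S$ with property $P$ and a congruence $\rho$ on $S$ such that the quotient semigroup $S/\rho$ does not have property $P$; (b) there exist semigroups $S$ and $T$, an $(S,T)$-biact $A$ with property $P$, and a congruence $\rho$ on $A$ such that the quotient biact $A/\rho$ does not have property $P$.
   Context: For a semigroup $S$, $S^1$ denotes the monoid obtained from $S$ by adjoining a new identity $1$, which acts as the identity on any biact. An $(S,T)$-biact is a set $A$ with maps $S\times A\to A$, $(s,a)\mapsto sa$, and $A\times T\to A$, $(a,t)\mapsto at$, such that $s(s'a)=(ss')a$, $(at)t'=a(tt')$ and $(sa)t=s(at)$ for all $a\in A$, $s,s'\in S$, $t,t'\in T$. On $A$ define preorders $a\leq_{\mathcal L}b\Leftrightarrow S^1a\subseteq S^1b$, $a\leq_{\mathcal R}b\Leftrightarrow aT^1\subseteq bT^1$, $a\leq_{\mathcal J}b\Leftrightarrow S^1aT^1\subseteq S^1bT^1$, with induced equivalence relations $\mathcal L,\mathcal R,\mathcal J$. The biact $A$ is left stable if $sa\,\mathcal J\,a\Rightarrow sa\,\mathcal L\,a$ for all $a\in A$, $s\in S$; right stable if $at\,\mathcal J\,a\Rightarrow at\,\mathcal R\,a$ for all $a\in A$, $t\in T$; stable if it is both left and right stable. A semigroup $S$ is left stable (right stable, stable) if ${}_SS_S$ is, where ${}_SS_S$ is $S$ regarded as an $(S,S)$-biact via left and right multiplication. A congruence on $A$ is an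 equivalence relation $\rho$ such that $(a,b)\in\rho$ implies $(sa,sb)\in\rho$ and $(at,bt)\in\rho$ for all $s\in S$, $t\in T$. The quotient $A/\rho$ is the $(S,T)$-biact of $\rho$-classes with actions $s[a]_\rho=[sa]_\rho$ and $[a]_\rho t=[at]_\rho$. *)

(* Defs.v *)
From HB Require Import structures.
From mathcomp Require Import all_boot.
From mathcomp Require Import classical_sets.
Set Implicit Arguments.
Unset Strict Implicit.
Unset Printing Implicit Defensive.

Local Open Scope group_scope.
Local Open Scope quotient_scope.
Local Open Scope classical_set_scope.

HB.mixin Record isBiact (S T : semigroupType) A := {
  lact : S -> A -> A;
  ract : A -> T -> A;
  lactA : forall s s' a, lact s (lact s' a) = lact (s * s') a;
  ractA : forall a t t', ract (ract a t) t' = ract a (t * t');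
  lractA : forall s a t, ract (lact s a) t = lact s (ract a t)
}.

#[short(type="biactType")]
HB.structure Definition Biact (S T : semigroupType) :=
  {A of isBiact S T A & Choice A}.

Section Stability.
Variables (S T : semigroupType) (A : biactType S T).
Implicit Types (a b : A) (s : S) (t : T).

(* The carrier of S^1 is option S, with None the adjoined identity; it is
   adjoined even when S already has one. *)
Definition lact1 (s : option S) a : A := if s is Some s' then lact s' a else a.
Definition ract1 a (t : option T) : A := if t is Some t' then ract a t' else a.

Definition Lideal a : set A := [set lact1 s a | s in [set: option S]].
Definition Rideal a : set A := [set ract1 a t | t in [set: option T]].
Definition Jideal a : set A :=
  [set ract1 (lact1 s a) t | s in [set: option S] & t in [set: option T]].

Definition leL a b := Lideal a `<=` Lideal b.
Definition leR a b := Rideal a `<=` Rideal b.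
Definition leJ a b := Jideal a `<=` Jideal b.

Definition eqL a b := leL a b /\ leL b a.
Definition eqR a b := leR a b /\ leR b a.
Definition eqJ a b := leJ a b /\ leJ b a.

Definition left_stable := forall a s, eqJ (lact s a) a -> eqL (lact s a) a.
Definition right_stable := forall a t, eqJ (ract a t) a -> eqR (ract a t) a.
Definition stable := left_stable /\ right_stable.

End Stability.
Arguments left_stable {S T} A.
Arguments right_stable {S T} A.
Arguments stable {S T} A.

Inductive stability := LeftStable | RightStable | Stable.

Definition biact_has (P : stability) (S T : semigroupType) (A : biactType S T)
    : Prop :=
  match P with
  | LeftStable => left_stable A
  | RightStable => right_stable A
  | Stable => stable A
  end.

(* S as an (S, S)-biact; the alias keeps the biact structure off S itself. *)
Definition regular (S : semigroupType) : Type := S.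

Section Regular.
Variable S : semigroupType.

HB.instance Definition _ := Choice.on (regular S).

Fact regular_lactA (s s' : S) (a : regular S) : s * (s' * a) = (s * s') * a.
Proof. exact: mulgA. Qed.

Fact regular_ractA (a : regular S) (t t' : S) : (a * t) * t' = a * (t * t').
Proof. by rewrite mulgA. Qed.

Fact regular_lractA (s : S) (a : regular S) (t : S) :
  (s * a) * t = s * (a * t).
Proof. by rewrite mulgA. Qed.

HB.instance Definition _ := @isBiact.Build S S (regular S)
  (fun s a => s * a) (fun a t => a * t)
  regular_lactA regular_ractA regular_lractA.

End Regular.

Definition semigroup_has (P : stability) (S : semigroupType) : Prop :=
  biact_has P (regular S).

(* The equivalence is boolean-valued, as required by {eq_quot _}; classically
   this is no restriction. *)
Record congruence (S T : semigroupType) (A : biactType S T) := Congruence {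
  cong_rel :> equiv_rel A;
  cong_lact : forall (s : S) (a b : A),
    cong_rel a b -> cong_rel (lact s a) (lact s b);
  cong_ract : forall (t : T) (a b : A),
    cong_rel a b -> cong_rel (ract a t) (ract b t)
}.

Definition biact_quot (S T : semigroupType) (A : biactType S T)
  (rho : congruence A) : Type := {eq_quot (cong_rel rho)}.

Section BiactQuotient.
Variables (S T : semigroupType) (A : biactType S T) (rho : congruence A).
Local Notation Q := (biact_quot rho).

HB.instance Definition _ := Choice.on Q.
HB.instance Definition _ := EqQuotient.on Q.

(* quot_lact_pi and quot_ract_pi show that these are s[a] = [sa] and
   [a]t = [at]. *)
Definition quot_lact (s : S) (x : Q) : Q := \pi_Q (lact s (repr x)).
Definition quot_ract (x : Q) (t : T) : Q := \pi_Q (ract (repr x) t).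

Lemma quot_lact_pi s (a : A) : quot_lact s (\pi_Q a) = \pi_Q (lact s a).
Proof.
apply/eqP; rewrite /quot_lact eqmodE; apply: cong_lact.
by rewrite -eqmodE; apply/eqP; exact: reprK.
Qed.

Lemma quot_ract_pi (a : A) t : quot_ract (\pi_Q a) t = \pi_Q (ract a t).
Proof.
apply/eqP; rewrite /quot_ract eqmodE; apply: cong_ract.
by rewrite -eqmodE; apply/eqP; exact: reprK.
Qed.

Fact quot_lactA s s' (x : Q) :
  quot_lact s (quot_lact s' x) = quot_lact (s * s') x.
Proof.
by elim/quotW: x => a; rewrite (quot_lact_pi s' a) 2!quot_lact_pi lactA.
Qed.

Fact quot_ractA (x : Q) t t' :
  quot_ract (quot_ract x t) t' = quot_ract x (t * t').
Proof.
by elim/quotW: x => a; rewrite (quot_ract_pi a t) 2!quot_ract_pi ractA.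
Qed.

Fact quot_lractA s (x : Q) t :
  quot_ract (quot_lact s x) t = quot_lact s (quot_ract x t).
Proof.
elim/quotW: x => a; rewrite (quot_ract_pi a t) (quot_lact_pi s a).
by rewrite quot_lact_pi quot_ract_pi lractA.
Qed.

HB.instance Definition _ := @isBiact.Build S T Q
  quot_lact quot_ract quot_lactA quot_ractA quot_lractA.

End BiactQuotient.

(* A congruence on a semigroup S is an equivalence compatible with left and
   right multiplication, i.e. a congruence on the biact regular S. *)
Definition semigroup_quot (S : semigroupType) (rho : congruence (regular S))
  : Type := {eq_quot (cong_rel rho)}.

Section SemigroupQuotient.
Variables (S : semigroupType) (rho : congruence (regular S)).
Local Notation Q := (semigroup_quot rho).

HB.instance Definition _ := Choice.on Q.
HB.instance Definition _ := EqQuotient.on Q.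

Definition quot_mul (x y : Q) : Q := \pi_Q ((repr x : S) * (repr y : S)).

Lemma quot_mul_pi (a b : S) : quot_mul (\pi_Q a) (\pi_Q b) = \pi_Q (a * b).
Proof.
have reprP (c : S) : cong_rel rho (repr (\pi_Q c)) c.
  by rewrite -eqmodE; apply/eqP; exact: reprK.
apply/eqP; rewrite /quot_mul eqmodE.
apply: equiv_trans (cong_ract (repr (\pi_Q b) : S) (reprP a)) _.
exact: cong_lact (a : S) _ _ (reprP b).
Qed.

Fact quot_mulA : associative quot_mul.
Proof.
elim/quotW=> a; elim/quotW=> b; elim/quotW=> c.
by rewrite (quot_mul_pi b c) (quot_mul_pi a b) 2!quot_mul_pi mulgA.
Qed.

HB.instance Definition _ := isSemigroup.Build Q quot_mulA.

End SemigroupQuotient.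

(* Main.v *)
Require Import Defs.
From HB Require Import structures.
From mathcomp Require Import all_boot.
From mathcomp Require Import classical_sets.
From mathcomp Require Import zify.

(** The free monoid on two letters is stable, since [|xsay| = |a|] forces
    [s = 1]. The bicyclic monoid [<p, q | pq = 1>] is a quotient of it and is
    neither left nor right stable: [1 = p1q] gives [p J 1] and [q J 1], but [p]
    has no left inverse and [q] has no right inverse. *)

Set Implicit Arguments.
Unset Strict Implicit.
Unset Printing Implicit Defensive.

Local Open Scope group_scope.
Local Open Scope quotient_scope.
Local Open Scope classical_set_scope.

Section Preorders.
Variables (S T : semigroupType) (A : biactType S T).
Implicit Types (a b : A) (s : S) (t : T).

Lemma lact1A (u v : option S) a :
  exists w : option S, lact1 u (lact1 v a) = lact1 w a.
Proof.
case: u v => [s|] [s'|] /=; [exists (Some (s * s'))|exists (Some s)|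
  exists (Some s')|exists None] => //=.
exact: lactA.
Qed.

Lemma ract1A a (u v : option T) :
  exists w : option T, ract1 (ract1 a u) v = ract1 a w.
Proof.
case: u v => [t|] [t'|] /=; [exists (Some (t * t'))|exists (Some t)|
  exists (Some t')|exists None] => //=.
exact: ractA.
Qed.

Lemma lract1A (u : option S) a (v : option T) :
  ract1 (lact1 u a) v = lact1 u (ract1 a v).
Proof. by case: u v => [s|] [t|] //=; exact: lractA. Qed.

Lemma Lideal_refl a : Lideal a a.
Proof. by exists None. Qed.

Lemma Rideal_refl a : Rideal a a.
Proof. by exists None. Qed.

Lemma Jideal_refl a : Jideal a a.
Proof. by exists None => //; exists None. Qed.

(** The ideal [Jideal b] absorbs both actions: since left and right actions commute, the two factors
    on each side can be brought together and merged. *)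
Lemma leJ_ideal a b : Jideal b a -> leJ a b.
Proof.
case=> u _ [v _ <-] _ [u' _ [v' _ <-]].
rewrite -lract1A; have [w ->] := lact1A u' u b.
have [z ->] := ract1A (lact1 w b) v v'.
by exists w => //; exists z.
Qed.

Lemma eqL_refl a : eqL a a.
Proof. by split. Qed.

Lemma eqR_refl a : eqR a a.
Proof. by split. Qed.

(** The equation [sat = a] makes [sa] and [a] J-equivalent, so left stability would place [a] in
    [Lideal (sa)]. *)
Lemma not_left_stable a s t :
  ract (lact s a) t = a -> (forall x, lact x (lact s a) <> a) ->
  ~ left_stable A.
Proof.
move=> sat_a noinv stA.
have [|_ /(_ _ (Lideal_refl a))] := stA a s.
  split; apply: leJ_ideal.
    by exists (Some s) => //; exists None.
  by exists None => //; exists (Some t).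
case=> -[x|] _ /=; first exact: noinv.
(* If the adjoined identity is the witness, then [sa = a], and [s] itself sends [sa] back to [a]. *)
by move=> sa_a; apply: (noinv s); rewrite !sa_a.
Qed.

Lemma not_right_stable a s t :
  ract (lact s a) t = a -> (forall x, ract (ract a t) x <> a) ->
  ~ right_stable A.
Proof.
move=> sat_a noinv stA.
have [|_ /(_ _ (Rideal_refl a))] := stA a t.
  split; apply: leJ_ideal.
    by exists None => //; exists (Some t).
  by exists (Some s) => //; exists None => //=; rewrite -lractA.
case=> -[x|] _ /=; first exact: noinv.
by move=> at_a; apply: (noinv t); rewrite !at_a.
Qed.

(** Together with [not_stable_has], this lets a single example settle all three values of [P]. *)
Lemma stable_has P : stable A -> biact_has P A.
Proof. by case: P => -[]. Qed.

Lemma not_stable_has P : ~ left_stable A -> ~ right_stable A -> ~ biact_has P A.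
Proof. by case: P => //= nl _ []. Qed.

End Preorders.

Definition word : Type := seq bool.

HB.instance Definition _ := Choice.on word.
HB.instance Definition _ := isSemigroup.Build word (@catA bool).

Lemma size_lact1 (u : option word) (a : regular word) :
  size a <= size (lact1 u a).
Proof. by case: u => //= s; rewrite size_cat leq_addl. Qed.

Lemma size_ract1 (a : regular word) (v : option word) :
  size a <= size (ract1 a v).
Proof. by case: v => //= t; rewrite size_cat leq_addr. Qed.

Lemma leJ_size (a b : regular word) : leJ a b -> size b <= size a.
Proof.
move=> /(_ _ (Jideal_refl a)) [u _ [v _ <-]].
exact: leq_trans (size_lact1 u b) (size_ract1 _ v).
Qed.

Lemma stable_word : stable (regular word).
Proof.
split=> a s [_ /leJ_size]; rewrite size_cat.
  by rewrite -[leqRHS]add0n leq_add2r leqn0 => /nilP->; exact: eqL_refl.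
rewrite -[leqRHS]addn0 leq_add2l leqn0 => /nilP->.
(* Unlike [[::] ++ a], the word [a ++ [::]] does not reduce to [a] by computation. *)
by rewrite /ract /= [_ * _]cats0; exact: eqR_refl.
Qed.

(* [(m, n)] stands for the normal form [q^m p^n]. *)
Definition bicyclic_mul (x y : nat * nat) : nat * nat :=
  (x.1 + (y.1 - x.2), y.2 + (x.2 - y.1))%N.

(** In [q^m p^n q^k p^l] the relation [pq = 1] cancels [min(n, k)] pairs in the middle, and the
    truncated subtractions count what survives. Associativity is thus a piecewise linear
    identity. *)
Lemma bicyclic_mulA : associative bicyclic_mul.
Proof. by move=> [a b] [c d] [e f]; congr pair => /=; lia. Qed.

Lemma bicyclic_mul1 : left_id (0, 0)%N bicyclic_mul.
Proof. by case=> a b; congr pair => /=; lia. Qed.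

Definition bicyclic_gen (b : bool) : nat * nat := if b then (0, 1)%N else (1, 0)%N.

Definition bicyclic_eval (w : word) : nat * nat :=
  foldr (fun b => bicyclic_mul (bicyclic_gen b)) (0, 0)%N w.

Lemma bicyclic_evalM (u v : word) :
  bicyclic_eval (u * v) = bicyclic_mul (bicyclic_eval u) (bicyclic_eval v).
Proof.
elim: u => [|b u IHu] /=; first by rewrite bicyclic_mul1.
by rewrite -bicyclic_mulA -IHu.
Qed.

Definition bicyclic_rel (u v : regular word) :=
  bicyclic_eval u == bicyclic_eval v.

Fact bicyclic_rel_equiv : equiv_class_of bicyclic_rel.
Proof.
split=> [u|u v|v u w]; rewrite /bicyclic_rel //.
by move=> /eqP->.
Qed.

Definition bicyclic_equiv := EquivRelPack bicyclic_rel_equiv.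

(** The kernel of the morphism [bicyclic_eval] respects both actions. The definition stays
    transparent so that [bicyclic_pq] holds by computation. *)
Definition bicyclic_cong : congruence (regular word).
Proof.
by exists bicyclic_equiv => s a b /eqP ab; apply/eqP;
  rewrite !bicyclic_evalM ab.
Defined.

Definition p : word := [:: true].
Definition q : word := [:: false].
Definition e : regular word := [::].

Lemma bicyclic_pq : bicyclic_cong (p * e * q) e.
Proof. by []. Qed.

(** Right multiplication by [p] takes [(m, n)] to [(m, n + 1)], which is never [(0, 0)]. *)
Lemma bicyclic_p_noinv (x : word) : ~ bicyclic_cong (x * (p * e)) e.
Proof.
move=> /eqP; rewrite bicyclic_evalM /bicyclic_mul /=.
by case: (bicyclic_eval x) => m n [] /=; lia.
Qed.

(** Left multiplication by [q] takes [(m, n)] to [(m + 1, n)]. *)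
Lemma bicyclic_q_noinv (x : word) : ~ bicyclic_cong (e * q * x) e.
Proof.
move=> /eqP; rewrite bicyclic_evalM /bicyclic_mul /=.
by case: (bicyclic_eval x) => m n [] /=; lia.
Qed.

Lemma biact_quot_unstable P : ~ biact_has P (biact_quot bicyclic_cong).
Proof.
pose e' : biact_quot bicyclic_cong := \pi e.
have pq1 : ract (lact p e') q = e'.
  rewrite [lact p e']quot_lact_pi [ract _ q]quot_ract_pi.
  by apply/eqP; rewrite eqmodE; exact: bicyclic_pq.
apply: not_stable_has.
  apply: (not_left_stable pq1) => x.
  rewrite [lact p e']quot_lact_pi [lact x _]quot_lact_pi => /eqP.
  by rewrite eqmodE; exact: bicyclic_p_noinv.
apply: (not_right_stable pq1) => x.
rewrite [ract e' q]quot_ract_pi [ract _ x]quot_ract_pi => /eqP.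
by rewrite eqmodE; exact: bicyclic_q_noinv.
Qed.

Lemma semigroup_quot_unstable P :
  ~ semigroup_has P (semigroup_quot bicyclic_cong).
Proof.
pose pi w : regular (semigroup_quot bicyclic_cong) :=
  \pi_(semigroup_quot bicyclic_cong) w.
have pq1 : ract (lact (pi p) (pi e)) (pi q) = pi e.
  rewrite [lact _ _]quot_mul_pi [ract _ _]quot_mul_pi.
  by apply/eqP; rewrite eqmodE; exact: bicyclic_pq.
apply: not_stable_has.
  (* Here the acting semigroup is the quotient itself, so the candidate inverse is a class and is
     first replaced by a representing word. *)
  apply: (not_left_stable pq1); elim/quotW => x.
  rewrite [lact (pi p) _]quot_mul_pi [lact _ _]quot_mul_pi => /eqP.
  by rewrite eqmodE; exact: bicyclic_p_noinv.
apply: (not_right_stable pq1); elim/quotW => x.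
rewrite [ract _ (pi q)]quot_mul_pi [ract _ _]quot_mul_pi => /eqP.
by rewrite eqmodE; exact: bicyclic_q_noinv.
Qed.

Theorem mainTheorem7 :
  forall P : stability,
    (exists (S : semigroupType) (rho : congruence (regular S)),
        semigroup_has P S /\ ~ semigroup_has P (semigroup_quot rho)) /\
    (exists (S T : semigroupType) (A : biactType S T) (rho : congruence A),
        biact_has P A /\ ~ biact_has P (biact_quot rho)).
Proof.
move=> P; split.
  exists word, bicyclic_cong.
  by split; [exact: stable_has stable_word|exact: semigroup_quot_unstable].
exists word, word, (regular word), bicyclic_cong.
by split; [exact: stable_has stable_word|exact: biact_quot_unstable].
Qed.
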